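(* Let $\mathbf{X}$ be an $m_n\times n$ anonymized database and $\mathbf{Y}$ the corresponding $m_n\times K_n$ labeled correlated database, with columns $C^{(2)}_1,\dots,C^{(2)}_{K_n}$, where $p_{X,Y}\neq p_Xp_Y$ and $s_{\max}\ge 2$. For $j=1,\dots,K_n-1$, let $E_j$ denote the event that the distribution-agnostic noisy replica detection algorithm (defined in the context) fails to infer the correct relationship (replicas or not) between $C^{(2)}_j$ and $C^{(2)}_{j+1}$. Then, given $m_n=\omega(\log n)$, $$\kappa^{(1)}_n\triangleq\Pr\Big(\bigcup_{j=1}^{K_n-1}E_j\Big)\to 0\quad\text{as } n\to\infty.$$
   Context: $[n]=\{1,\dots,n\}$. **Databases.** Let $\mathcal{X}=\{1,\dots,|\mathcal{X}|\}$ be a finite alphabet and $p_X$ a probability distribution with support $\mathcal{X}$. The anonymized database is a random $m_n\times n$ matrix $\mathbf{X}=(X_{i,j})$ with i.i.d. entries $X_{i,j}\sim p_X$. The column repetition pattern is $S^n=(S_1,\dots,S_n)$, independent of $\mathbf{X}$, with $S_j$ i.i.d. $\sim p_S$, where $p_S$ has finite integer support $\{0,\dots,s_{\max}\}$ and does not depend on $n$. The anonymization function $\sigma_n$ is a uniformly random permutation of $[m_n]$, independent of the rest. The obfuscation distribution $p_{Y|X}$ is a conditional distribution from $\mathcal{X}$ to $\mathcal{X}$. Write $p_{X,Y}(x,y)=p_X(x)p_{Y|X}(y|x)$ and let $p_Y$ be its second marginal. Put $K_0=0$ and $K_j=\sum_{t=1}^jS_t$. The labeled correlated database $\mathbf{Y}$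 is the $m_n\times K_n$ matrix such that, given $\mathbf{X},S^n,\sigma_n$, its entries are conditionally independent and $Y_{\sigma_n(i),K_{j-1}+s}\sim p_{Y|X}(\cdot\mid X_{i,j})$ for all $i\in[m_n]$, $j\in[n]$, $1\le s\le S_j$. Two consecutive columns $C^{(2)}_j,C^{(2)}_{j+1}$ of $\mathbf{Y}$ are (noisy) replicas if they come from the same column of $\mathbf{X}$, i.e. $K_{t-1}<j<j+1\le K_t$ for some $t\in[n]$. Otherwise they are not replicas (and are independent). **Algorithm (distribution-agnostic noisy replica detection).** The input is $\mathbf{Y}$ only. 1. Compute the running Hamming distances $W_j=\sum_{t=1}^{m_n}\mathbf{1}_{[Y_{t,j+1}\neq Y_{t,j}]}$ for $j\in[K_n-1]$. 2. Compute the sample factorial moments $$F_k=\frac{1}{K_n-1}\sum_{j=1}^{K_n-1}\prod_{i=0}^{k-1}\frac{W_j-i}{m_n-i},\qquad k=1,2,3,$$ then $U=\dfrac{F_3-F_1F_2}{F_2-F_1^2}$ and $$\hat p_0=\frac{U+\sqrt{U^2-4UF_1+4F_2}}{2},\qquad \hat p_1=\frac{U-\sqrt{U^2-4UF_1+4F_2}}{2}.$$ 3. Set $\tau=\frac{\hat p_0+\hat p_1}{2}$. For each $j\in[K_n-1]$, declare $C^{(2)}_j$ and $C^{(2)}_{j+1}$ to be replicas if $W_j\le m_n\tau$, and not replicas otherwise. (If these quantities are undefined, the algorithm is considered to fail.) *)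

(* Defs.v *)
From HB Require Import structures.
From mathcomp Require Import all_boot all_order all_algebra all_fingroup.
From mathcomp Require Import all_classical all_reals all_analysis.

Set Implicit Arguments.
Unset Strict Implicit.
Unset Printing Implicit Defensive.

Import Order.TTheory GRing.Theory Num.Theory.
Import numFieldNormedType.Exports.

Local Open Scope classical_set_scope.
Local Open Scope ring_scope.

(** Rows and columns are numbered from 0: the ordinal [j] stands for the
    1-based index [j + 1]. *)

Definition is_pmf (R : realType) (I : finType) (p : I -> R) : Prop :=
  (forall i, 0 <= p i) /\ \sum_i p i = 1.

Definition is_channel (R : realType) (A : finType) (pYX : A -> A -> R) : Prop :=
  forall x, is_pmf (pYX x).

Definition full_support (R : realType) (I : finType) (p : I -> R) : Prop :=
  forall i, 0 < p i.

Definition joint_pmf (R : realType) (A : finType)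
    (pX : A -> R) (pYX : A -> A -> R) (x y : A) : R :=
  pX x * pYX x y.

Definition output_pmf (R : realType) (A : finType)
    (pX : A -> R) (pYX : A -> A -> R) (y : A) : R :=
  \sum_x joint_pmf pX pYX x y.

Section RepetitionPattern.
Variables (smax n : nat) (s : {ffun 'I_n -> 'I_smax.+1}).

Definition cumul (j : nat) : nat := (\sum_(t < n | (t < j)%N) s t)%N.

Definition width : nat := cumul n.

(** Columns [k] and [k.+1] of the second database come from the same column
    [t] of the first one: column [t] produces exactly the columns [k] with
    [cumul t <= k < cumul t.+1]. *)
Definition replicas (k : nat) : bool :=
  [exists t : 'I_n, (cumul t <= k)%N && (k.+1 < cumul t.+1)%N].

End RepetitionPattern.

(** Joint probability mass function of (X, S^n, sigma_n, Y): the entries of X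
    are i.i.d. [pX], the S_j are i.i.d. [pS], sigma_n is uniform, these three
    are independent, and given them the entries of Y are independent, the one
    in row [sigma i] and column [k] having law [pYX (x i j)] when [k] comes from
    column [j] of X. *)
Definition database_pmf (R : realType) (A : finType) (smax m n : nat)
    (pX : A -> R) (pYX : A -> A -> R) (pS : 'I_smax.+1 -> R)
    (x : 'M[A]_(m, n)) (s : {ffun 'I_n -> 'I_smax.+1}) (sigma : {perm 'I_m})
    (y : 'M[A]_(m, width s)) : R :=
  (\prod_(i < m) \prod_(j < n) pX (x i j)) *
  (\prod_(j < n) pS (s j)) *
  (m`!%:R)^-1 *
  \prod_(i < m) \prod_(j < n)
    \prod_(k < width s | (cumul s j <= k < cumul s j.+1)%N)
      pYX (x i j) (y (sigma i) k).

(** The random elements [X], [S], [sigma], [Y] on the probability space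
    [(T, P)] have the joint law [database_pmf].  As the number of columns of
    [Y w] depends on [S w], the pair [(S w, Y w)] is compared with [(s, y)] as
    an element of a sigma type.  All the value spaces being finite, the
    measurability of the atoms is that of the random elements. *)
Definition correlated_databases (R : realType) (A : finType) (smax m n : nat)
    (pX : A -> R) (pYX : A -> A -> R) (pS : 'I_smax.+1 -> R)
    (d : measure_display) (T : measurableType d) (P : probability T R)
    (X : T -> 'M[A]_(m, n)) (S : T -> {ffun 'I_n -> 'I_smax.+1})
    (sigma : T -> {perm 'I_m}) (Y : forall w : T, 'M[A]_(m, width (S w))) :
    Prop :=
  forall x s pi (y : 'M[A]_(m, width s)),
    let atom := [set w : T | [/\ X w = x, sigma w = pi &
      existT (fun s' => 'M[A]_(m, width s')) (S w) (Y w) =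
      existT (fun s' => 'M[A]_(m, width s')) s y]] in
    measurable atom /\ P atom = (database_pmf pX pYX pS x pi y)%:E.

Section Algorithm.
Variables (R : realType) (A : finType) (m K : nat) (y : 'M[A]_(m, K)).

Lemma rcol_subproof (j : 'I_K.-1) : (j.+1 < K)%N.
Proof. by rewrite -ltn_predRL. Qed.

Definition lcol (j : 'I_K.-1) : 'I_K := widen_ord (leq_pred K) j.
Definition rcol (j : 'I_K.-1) : 'I_K := Ordinal (rcol_subproof j).

Definition running_hamming (j : 'I_K.-1) : nat :=
  (\sum_(t < m) (y t (rcol j) != y t (lcol j)))%N.

Definition factorial_moment (k : nat) : R :=
  (K.-1%:R)^-1 * \sum_(j < K.-1)
    \prod_(i < k) (((running_hamming j)%:R - i%:R) / (m%:R - i%:R)).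

Local Notation F := factorial_moment.

Definition U_stat : R := (F 3 - F 1 * F 2) / (F 2 - F 1 ^+ 2).

Definition discr : R := U_stat ^+ 2 - 4 * U_stat * F 1 + 4 * F 2.

Definition p0_hat : R := (U_stat + Num.sqrt discr) / 2.
Definition p1_hat : R := (U_stat - Num.sqrt discr) / 2.

Definition threshold : R := (p0_hat + p1_hat) / 2.

(** No division by zero in [F 1], [F 2], [F 3], [U_stat], and a real square
    root. *)
Definition well_defined : bool :=
  [&& (0 < K.-1)%N, (2 < m)%N, F 2 - F 1 ^+ 2 != 0 & 0 <= discr].

(** [Some true]: declared replicas; [Some false]: declared not replicas;
    [None]: the algorithm fails. *)
Definition detect (j : 'I_K.-1) : option bool :=
  if well_defined then Some ((running_hamming j)%:R <= m%:R * threshold)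
  else None.

End Algorithm.

(** Failure on the pair of columns [j], [j.+1].  The number of pairs is random:
    the event only contains outcomes for which column [j.+1] exists, so the
    union over all [j : nat] is the union over the pairs actually present. *)
Definition detection_error (R : realType) (A : finType) (smax m n : nat)
    (T : Type) (S : T -> {ffun 'I_n -> 'I_smax.+1})
    (Y : forall w : T, 'M[A]_(m, width (S w))) (j : nat) : set T :=
  [set w | exists lt_j : (j < (width (S w)).-1)%N,
     detect R (Y w) (Ordinal lt_j) <> Some (replicas (S w) j)].

(* Main.v *)
(** A pair of consecutive columns of [Y] disagrees in each row, independently,
    with probability [p0] or [p1] according to whether the columns come from
    different columns of [X] or from the same one; [p0 - p1] is a sum of
    variances, positive because [X] and [Y] are dependent.  A Chernoff bound and
    a union bound put every [W_j / m] within a constant [e] of its mean: there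
    are [O(n)] pairs, and [n exp(- c m)] vanishes as [m] grows faster than
    [log n].  Another Chernoff bound produces a positive fraction of columns
    repeated at least twice, hence positive fractions [a] and [1 - a] of
    replicas and of non-replicas.  The rest is deterministic: each factor
    [(W_j - i) / (m - i)] is close to [p0] or [p1], so [F_k] is close to
    [a p1^k + (1 - a) p0^k], and [U] is close to [p0 + p1].  The square root
    cancels in the threshold [U / 2], and it is real because the discriminant is
    [(U - 2 F_1)^2 + 4 (F_2 - F_1^2)]. *)

Require Import Defs.
From HB Require Import structures.
From mathcomp Require Import all_boot all_order all_algebra all_fingroup.
From mathcomp Require Import all_classical all_reals all_analysis.
From mathcomp Require Import ring lra zify.

Import Order.TTheory GRing.Theory Num.Theory.
Import numFieldNormedType.Exports.

Local Open Scope ring_scope.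

(** * Combinatorics of the repetition pattern *)

Section Blocks.
Local Open Scope nat_scope.
Context {smax n : nat}.
Implicit Type s : {ffun 'I_n -> 'I_smax.+1}.

Lemma cumul0 s : cumul s 0 = 0.
Proof. by rewrite /cumul big_pred0. Qed.

Lemma cumulS s (t : 'I_n) : cumul s t.+1 = cumul s t + s t.
Proof.
rewrite /cumul (bigD1 t) //= addnC; congr (_ + _).
by apply: eq_bigl => i; rewrite ltnS [in RHS]ltn_neqAle andbC.
Qed.

Lemma cumul_mono s i j : i <= j -> cumul s i <= cumul s j.
Proof.
move=> ij; rewrite /cumul [leqRHS](bigID (fun t : 'I_n => t < i)) /=.
apply: leq_trans (leq_addr _ _); rewrite leq_eqVlt; apply/orP; left; apply/eqP.
by apply: eq_bigl => t; case: ltnP => [ti|]; rewrite ?andbF // (leq_trans ti ij).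
Qed.

Lemma width_le s : width s <= smax * n.
Proof.
rewrite /width /cumul.
have -> : smax * n = \sum_(t < n) smax by rewrite sum_nat_const card_ord mulnC.
by rewrite big_mkcond leq_sum // => t _; rewrite ltn_ord -ltnS ltn_ord.
Qed.

Definition in_block s (t : 'I_n) (k : nat) := (cumul s t <= k < cumul s t.+1).

Lemma in_block_inj s k t u : in_block s t k -> in_block s u k -> t = u.
Proof.
move=> /andP[t1 t2] /andP[u1 u2].
case: (ltngtP (val t) (val u)) => [h|h|/val_inj //].
  by have := leq_ltn_trans (leq_trans (cumul_mono s _ _ h) u1) t2; rewrite ltnn.
by have := leq_ltn_trans (leq_trans (cumul_mono s _ _ h) t1) u2; rewrite ltnn.
Qed.

(** The least [j] with [k < cumul s j] is positive, as [cumul s 0 = 0]; its predecessor is the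
    block. The result is informative so that [origin] can be a function. *)
Lemma ex_block s k : k < width s -> {t | in_block s t k}.
Proof.
move=> kw; have ex : exists j, k < cumul s j by exists n.
case: (ex_minnP ex) => -[|j]; first by rewrite cumul0.
move=> kj jmin; have jn : j < n by exact: jmin.
exists (Ordinal jn); rewrite /in_block kj andbT leqNgt.
by apply/negP => /jmin; rewrite /= ltnn.
Qed.

Definition origin s (k : 'I_(width s)) : 'I_n := sval (ex_block s k (ltn_ord k)).

Lemma origin_block s (k : 'I_(width s)) t : in_block s t k = (t == origin s k).
Proof.
rewrite /origin; case: ex_block => u hu /=.
by apply/idP/eqP => [ht|-> //]; apply: in_block_inj ht hu.
Qed.

Lemma replicasE s (j : 'I_(width s).-1) :
  replicas s j = (origin s (lcol j) == origin s (rcol j)).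
Proof.
apply/existsP/eqP => [[t /andP[t1 t2]]|].
  have /eqP <- : t == origin s (lcol j).
    by rewrite -origin_block /in_block t1 /= (ltnW t2).
  by apply/eqP; rewrite -origin_block /in_block t2 andbT (leq_trans t1) /=.
move=> e; exists (origin s (lcol j)).
have := eqxx (origin s (lcol j)); rewrite -origin_block => /andP[-> _] /=.
by move/eqP: e; rewrite -origin_block => /andP[].
Qed.

(** A sum of i.i.d. indicators, hence open to a Chernoff bound, that bounds from below the number of
    replica pairs and, up to one, that of the other pairs. *)
Definition repeated s : nat := #|[set t | 2 <= s t]|.

(** Each column repeated at least twice yields the pair of its first two copies, and blocks are
    disjoint. [insub] makes the index total in [t]. *)
Lemma repeated_replicas s :
  repeated s <= #|[set j : 'I_(width s).-1 | replicas s j]|.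
Proof.
pose f (t : 'I_n) : option 'I_(width s).-1 := insub (cumul s t).
have fE t : 2 <= s t -> exists2 j, f t = Some j & cumul s t = j /\ replicas s j.
  move=> st; have ht := cumulS s t.
  have hw : (cumul s t).+1 < width s.
    by apply: leq_trans (cumul_mono s _ _ (ltn_ord t)); rewrite ht; lia.
  have hw' : cumul s t < (width s).-1 by lia.
  rewrite /f insubT; eexists; first by []; split => //=.
  by apply/existsP; exists t; rewrite leqnn ht /=; lia.
have finj : {in [set t | 2 <= s t] &, injective f}.
  move=> t u; rewrite !inE => st su e.
  case: (fE t st) => j fj [tj _]; case: (fE u su) => i fi [ui _].
  have ij : i = j by apply: Some_inj; rewrite -fi -fj.
  apply: (in_block_inj s j); rewrite /in_block cumulS.
    by rewrite tj leqnn -[ltnLHS]addn0 ltn_add2l ltnW.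
  by rewrite ui ij leqnn -[ltnLHS]addn0 ltn_add2l ltnW.
rewrite /repeated -(card_in_imset finj) -[leqRHS](card_imset _ (@Some_inj _)).
apply: fintype.subset_leq_card; apply/fintype.subsetP => o /imsetP[t]; rewrite inE => st ->.
by have [j -> [_ rj]] := fE _ st; apply: imset_f; rewrite inE.
Qed.

(** Each repeated column is sent to its last copy, whose right neighbour lies in another block. The
    last repeated column [l] is left out; its presence gives every earlier one a right neighbour. *)
Lemma repeated_nonreplicas s :
  (repeated s).-1 <= #|[set j : 'I_(width s).-1 | ~~ replicas s j]|.
Proof.
case: (posnP (repeated s)) => [->//|].
rewrite /repeated => /card_gt0P [t0 ht0].
(* The last column that is repeated may also be the last nonempty one. *)
case: (@arg_maxnP _ t0 (fun t => t \in [set t | 2 <= s t]) val ht0) => l hl lmax.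
rewrite (cardsD1 l) hl add1n /=.
pose f (t : 'I_n) : option 'I_(width s).-1 := insub (cumul s t.+1).-1.
have fE t : t \in [set t | 2 <= s t] :\ l ->
    exists2 j, f t = Some j & in_block s t j /\ ~~ replicas s j.
  rewrite !inE => /andP[tl st]; have ht := cumulS s t.
  have ltl : t < l by rewrite ltn_neqAle; apply/andP; split=> //; apply: lmax; rewrite inE.
  have h1 := cumul_mono s _ _ ltl; have h2 := cumulS s l.
  have h3 := cumul_mono s _ _ (ltn_ord l).
  have sl : 2 <= s l by move: hl; rewrite inE.
  have h4 : width s = cumul s n by [].
  have hw' : (cumul s t.+1).-1 < (width s).-1 by lia.
  have hb : in_block s t (cumul s t.+1).-1 by rewrite /in_block; lia.
  rewrite /f insubT; eexists; first by []; split => //=.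
  apply/existsP => -[u /andP[u1 u2]].
  have tu : u = t by apply: (in_block_inj s (cumul s t.+1).-1) => //; rewrite /in_block u1 /=; lia.
  by move: u2; rewrite tu; lia.
have finj : {in [set t | 2 <= s t] :\ l &, injective f}.
  move=> t u st su e.
  case: (fE t st) => j fj [tj _]; case: (fE u su) => i fi [ui _].
  have ij : i = j by apply: Some_inj; rewrite -fi -fj.
  by apply: (in_block_inj s j) => //; rewrite -ij.
rewrite -(card_in_imset finj) -[leqRHS](card_imset _ (@Some_inj _)).
apply: fintype.subset_leq_card; apply/fintype.subsetP => o /imsetP[t] st ->.
by have [j -> [_ rj]] := fE _ st; apply: imset_f; rewrite inE.
Qed.

End Blocks.

(** * Deterministic correctness of the estimated threshold *)

Section Threshold.
Context {R : realType}.

(** The numerator of the difference is [(w - m * p) - i * (1 - p)], at most [e * m + 2] in absolute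
    value, and [e * m + 2 <= 2 * e * (m - 2)] because [4 <= e * m] and [e <= 1/2]. These also give
    [8 <= m], which keeps the ratio above -1 even when [w < i]. *)
Lemma factorial_ratio_bound (w m p e : R) i :
  0 <= w <= m -> 0 <= p <= 1 -> 0 < e <= 2^-1 -> 4 <= e * m -> (i <= 2)%N ->
  `|w - m * p| <= e * m ->
  `|(w - i%:R) / (m - i%:R)| <= 1 /\ `|(w - i%:R) / (m - i%:R) - p| <= 2 * e.
Proof.
move=> /andP[w0 wm] /andP[p0 p1] /andP[e0 e1] em i2 wp.
have [i0 ib] : 0 <= i%:R :> R /\ i%:R <= 2 :> R by rewrite ler0n (ler_nat _ i 2).
have m8 : 8 <= m by nra.
have mi : 0 < m - i%:R by lra.
rewrite ler_norml in wp; case/andP: wp => wp1 wp2.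
split.
  by rewrite ler_norml ler_pdivlMr // ler_pdivrMr //; apply/andP; split; lra.
have -> : (w - i%:R) / (m - i%:R) - p = (w - i%:R - p * (m - i%:R)) / (m - i%:R).
  by field; apply/eqP; lra.
by rewrite ler_norml ler_pdivlMr // ler_pdivrMr //; apply/andP; split; nra.
Qed.

(** Induction on [k]: replacing one factor costs [e], since all the other factors are bounded by
    1. *)
Lemma prod_approx k (f : nat -> R) (p e : R) :
  0 <= p <= 1 -> 0 <= e ->
  (forall i, (i < k)%N -> `|f i| <= 1 /\ `|f i - p| <= e) ->
  `|\prod_(i < k) f i| <= 1 /\ `|\prod_(i < k) f i - p ^+ k| <= k%:R * e.
Proof.
move=> /andP[p0 p1] e0; elim: k => [|k IH] hf.
  by rewrite big_ord0 expr0 subrr normr0 normr1 mul0r.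
have [|IH1 IH2] := IH; first by move=> i ik; apply: hf; rewrite ltnS ltnW.
have [f1 f2] := hf k (ltnSn k).
rewrite big_ord_recr /= exprSr; set a := \prod_(i < k) f i in IH1 IH2 *.
split; first by rewrite normrM; apply: mulr_ile1.
have -> : a * f k - p ^+ k * p = (a - p ^+ k) * p + a * (f k - p) by ring.
apply: le_trans (ler_normD _ _) _; rewrite !normrM (ger0_norm p0) -natr1 mulrDl mul1r.
apply: lerD.
  by apply: le_trans IH2; rewrite ler_piMr.
by apply: le_trans f2; rewrite ler_piMl.
Qed.

Lemma mean_approx (N : nat) (f g : 'I_N -> R) (e : R) : (0 < N)%N ->
  (forall j, `|f j - g j| <= e) ->
  `|N%:R^-1 * (\sum_(j < N) f j) - N%:R^-1 * (\sum_(j < N) g j)| <= e.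
Proof.
move=> N0 h; rewrite -mulrBr -sumrB normrM gtr0_norm ?invr_gt0 ?ltr0n //.
rewrite mulrC ler_pdivrMr ?ltr0n //.
apply: le_trans (ler_norm_sum _ _ _) _.
apply: le_trans (ler_sum _ (fun j _ => h j)) _.
by rewrite sumr_const card_ord mulr_natr.
Qed.

(* [f1], [f2], [f3] are the moments of the two-point law [a p1 + (1 - a) p0]:
   its variance is [a (1 - a) (p0 - p1)^2], and the covariance of the identity
   and the square is [p0 + p1] times that. *)
Lemma U_close (a p0 p1 d e F1 F2 F3 : R) :
  0 <= p1 < p0 -> p0 <= 1 -> 0 < d -> d <= a <= 1 - d ->
  0 <= e -> e * 36 <= d ^+ 2 * (p0 - p1) ^+ 2 ->
  `|F1| <= 1 -> `|F2| <= 1 ->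
  `|F1 - (a * p1 + (1 - a) * p0)| <= 6 * e ->
  `|F2 - (a * p1 ^+ 2 + (1 - a) * p0 ^+ 2)| <= 6 * e ->
  `|F3 - (a * p1 ^+ 3 + (1 - a) * p0 ^+ 3)| <= 6 * e ->
  0 < F2 - F1 ^+ 2 /\
  `|(F3 - F1 * F2) / (F2 - F1 ^+ 2) - (p0 + p1)| * (d ^+ 2 * (p0 - p1) ^+ 2)
    <= 108 * e.
Proof.
move=> /andP[p1_0 p10] p0_1 d0 /andP[da ad] e0 he F1b F2b h1 h2 h3.
set f1 := (a * p1 + _) in h1; set f2 := (a * p1 ^+ 2 + _) in h2.
set f3 := (a * p1 ^+ 3 + _) in h3; set v0 := (d ^+ 2 * _) in he *.
pose v := a * (1 - a) * (p0 - p1) ^+ 2.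
have v0v : v0 <= v.
  rewrite /v0 /v ler_wpM2r ?sqr_ge0 // expr2; apply: ler_pM; lra.
have v0_gt0 : 0 < v0 by rewrite mulr_gt0 ?exprn_gt0 // subr_gt0.
have E1 : f2 - f1 ^+ 2 = v by rewrite /f2 /f1 /v; ring.
have E2 : f3 - f1 * f2 = (p0 + p1) * v by rewrite /f3 /f2 /f1 /v; ring.
have f1b : `|f1| <= 1 by rewrite ler_norml /f1; apply/andP; split; nra.
have Dd : `|(F2 - F1 ^+ 2) - v| <= 18 * e.
  rewrite -E1 (_ : _ - _ = (F2 - f2) - (F1 - f1) * F1 - f1 * (F1 - f1)); last by ring.
  have a1 : `|(F1 - f1) * F1| <= 6 * e.
    by rewrite normrM; apply: le_trans h1; rewrite ler_piMr.
  have a2 : `|f1 * (F1 - f1)| <= 6 * e.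
    by rewrite normrM; apply: le_trans h1; rewrite ler_piMl.
  move: h2 a1 a2; rewrite !ler_norml => /andP[? ?] /andP[? ?] /andP[? ?].
  by apply/andP; split; lra.
have Dn : `|(F3 - F1 * F2) - (p0 + p1) * v| <= 18 * e.
  rewrite -E2 (_ : _ - _ = (F3 - f3) - (F1 - f1) * F2 - f1 * (F2 - f2)); last by ring.
  have a1 : `|(F1 - f1) * F2| <= 6 * e.
    by rewrite normrM; apply: le_trans h1; rewrite ler_piMr.
  have a2 : `|f1 * (F2 - f2)| <= 6 * e.
    by rewrite normrM; apply: le_trans h2; rewrite ler_piMl.
  move: h3 a1 a2; rewrite !ler_norml => /andP[? ?] /andP[? ?] /andP[? ?].
  by apply/andP; split; lra.
set D := F2 - F1 ^+ 2 in Dd *; set N := F3 - F1 * F2 in Dn *.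
(* The error is absorbed by [36 * e <= v0 <= v]: [D >= v - 18 * e >= v0 / 2]. *)
have Dv0 : v0 <= 2 * D by move: Dd; rewrite ler_norml => /andP[? ?]; lra.
have D0 : 0 < D by lra.
split=> //.
have -> : N / D - (p0 + p1) = (N - (p0 + p1) * D) / D by field; apply/eqP; lra.
(* [54 = 18 + 2 * 18], because [p0 + p1 <= 2]. The bound [1 / D <= 2 / v0] then doubles this to
   108. *)
have ND : `|N - (p0 + p1) * D| <= 54 * e.
  move: Dd Dn; rewrite !ler_norml => /andP[? ?] /andP[? ?].
  by apply/andP; split; nra.
rewrite normrM normfV (gtr0_norm D0) mulrAC ler_pdivrMr //.
have n0 := normr_ge0 (N - (p0 + p1) * D).
nra.
Qed.

(* [e] must satisfy [36 e <= v0] and [e + 54 e / v0 < (p0 - p1) / 2], where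
   [v0 = d^2 (p0 - p1)^2] bounds the variance of the mixture from below. *)
Lemma detect_correct (A : finType) (m K : nat) (y : 'M[A]_(m, K))
    (rep : 'I_K.-1 -> bool) (p0 p1 d e : R) :
  0 <= p1 < p0 -> p0 <= 1 -> 0 < d <= 1 ->
  e = d ^+ 2 * (p0 - p1) ^+ 3 / 300 ->
  4 <= e * m%:R -> (0 < K.-1)%N ->
  d * K.-1%:R <= #|[set j | rep j]|%:R ->
  d * K.-1%:R <= #|[set j | ~~ rep j]|%:R ->
  (forall j, `|(running_hamming y j)%:R - m%:R * (if rep j then p1 else p0)|
     <= e * m%:R) ->
  forall j, detect R y j = Some (rep j).
Proof.
move=> /andP[p1_0 p10] p0_1 /andP[d0 d1] eE em K0 drep dnrep hW j.
have D0 : 0 < p0 - p1 by lra.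
have D1 : p0 - p1 <= 1 by lra.
have v0_gt0 : 0 < d ^+ 2 * (p0 - p1) ^+ 2 by rewrite mulr_gt0 ?exprn_gt0.
set v0 := d ^+ 2 * (p0 - p1) ^+ 2 in v0_gt0.
have v01 : v0 <= 1 by rewrite /v0 mulr_ile1 ?exprn_ile1 ?exprn_ge0 //; lra.
have eE' : e * 300 = v0 * (p0 - p1) by rewrite eE /v0; field.
have vD := mulr_gt0 v0_gt0 D0.
have e0 : 0 < e by lra.
have ev : e * 300 <= v0 by rewrite eE' ler_piMr // ltW.
have eD : e * 300 <= p0 - p1 by rewrite eE' ler_piMl // ltW.
have e_half : 0 < e <= 2^-1 by apply/andP; split; lra.
have m8 : 8 <= m%:R :> R by nra.
have m2 : (2 < m)%N by rewrite -(ltr_nat R); lra.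
pose pj j := if rep j then p1 else p0.
have pjb i : 0 <= pj i <= 1 by rewrite /pj; case: (rep i); apply/andP; split; lra.
pose G k i := \prod_(l < k) (((running_hamming y i)%:R - l%:R) / (m%:R - l%:R)) : R.
pose w i : R := (running_hamming y i)%:R.
have wb i : 0 <= w i <= m%:R.
  rewrite /w ler0n ler_nat /running_hamming; apply/andP; split=> //.
  apply: leq_trans (leq_sum _ (fun t _ => leq_b1 _)) _.
  by rewrite sum_nat_const card_ord muln1.
have GB k i : (k <= 3)%N -> `|G k i| <= 1 /\ `|G k i - pj i ^+ k| <= 6 * e.
  move=> k3; have [||? h] := @prod_approx k
    (fun l => ((running_hamming y i)%:R - l%:R) / (m%:R - l%:R)) (pj i) (2 * e) (pjb i).
  - lra.
  - move=> l lk; apply: (factorial_ratio_bound _ _ _ _ _ (wb i) (pjb i) e_half em _ (hW i)).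
    by rewrite -ltnS (leq_trans lk).
  split=> //; apply: le_trans h _.
  by have : k%:R <= 3%:R :> R by [rewrite ler_nat]; nra.
have FE k : factorial_moment R y k = K.-1%:R^-1 * \sum_(i < K.-1) G k i by [].
have Fb k : (k <= 3)%N -> `|factorial_moment R y k| <= 1.
  move=> k3; have := @mean_approx K.-1 (G k) (fun=> 0) 1 K0.
  have s0 : \sum_(i < K.-1) (0 : R) = 0 by rewrite big1.
  rewrite FE s0 mulr0 subr0; apply => i.
  by rewrite subr0; case: (GB k i k3).
pose nr : R := #|[set i | rep i]|%:R; pose nn : R := #|[set i | ~~ rep i]|%:R.
have nE : nr + nn = K.-1%:R.
  rewrite /nr /nn -natrD; congr (_%:R).
  rewrite -[RHS]card_ord -(cardsC [set i | rep i]); congr (_ + _)%N.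
  by apply: eq_card => i; rewrite !inE.
have NR0 : 0 < K.-1%:R :> R by rewrite ltr0n.
pose a := nr / K.-1%:R.
have aN : a * K.-1%:R = nr by rewrite /a divfK // gt_eqF.
have Fc k : (k <= 3)%N ->
    `|factorial_moment R y k - (a * p1 ^+ k + (1 - a) * p0 ^+ k)| <= 6 * e.
  move=> k3; have := @mean_approx K.-1 (G k) (fun i => pj i ^+ k) (6 * e) K0.
  rewrite FE (_ : K.-1%:R^-1 * (\sum_(i < K.-1) pj i ^+ k) = a * p1 ^+ k + (1 - a) * p0 ^+ k).
    by apply => i; case: (GB k i k3).
  rewrite (bigID rep) /= (eq_bigr (fun=> p1 ^+ k)); last by rewrite /pj => i ->.
  rewrite [X in _ + X](eq_bigr (fun=> p0 ^+ k)); last by rewrite /pj => i /negbTE ->.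
  rewrite !sumr_const.
  have -> : #|[pred i | rep i]| = #|[set i | rep i]|.
    by apply: eq_card => i; rewrite !inE.
  have -> : #|[pred i | ~~ rep i]| = #|[set i | ~~ rep i]|.
    by apply: eq_card => i; rewrite !inE.
  rewrite -!(mulr_natl (_ ^+ _)) -/nr -/nn /a.
  have -> : nn = K.-1%:R - nr by rewrite -nE; ring.
  by field; rewrite gt_eqF.
have ab : d <= a <= 1 - d.
  rewrite -/nr -/nn in drep dnrep.
  apply/andP; split; first by rewrite /a ler_pdivlMr.
  by rewrite /a ler_pdivrMr // mulrBl mul1r; lra.
have [||FD UD] := @U_close a p0 p1 d e _ _ _ _ p0_1 d0 ab (ltW e0) _
  (Fb 1%N isT) (Fb 2%N isT) (Fc 1%N isT) (Fc 2%N isT) (Fc 3%N isT).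
- by rewrite p1_0.
- by rewrite -/v0; lra.
have wd : well_defined R y.
  rewrite /well_defined K0 m2 (gt_eqF FD) /=.
  rewrite /discr (_ : _ + _ = (U_stat R y - 2 * factorial_moment R y 1) ^+ 2 +
     4 * (factorial_moment R y 2 - factorial_moment R y 1 ^+ 2)); last by ring.
  by rewrite addr_ge0 ?sqr_ge0 // mulr_ge0 // ltW.
rewrite /detect wd; congr Some.
have -> : threshold R y = U_stat R y / 2.
  by rewrite /threshold /p0_hat /p1_hat; field.
rewrite -/(U_stat R y) -/v0 in UD; set U := U_stat R y in UD *.
(* [U / 2] is thus within [0.18 * (p0 - p1)] of the midpoint of [p0] and [p1], and each Hamming
   distance divided by [m] within [(p0 - p1) / 300] of its mean: together less than half the gap. *)
have Ub : `|U - (p0 + p1)| * 300 <= 108 * (p0 - p1).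
  rewrite -(ler_pM2r v0_gt0).
  have -> : 108 * (p0 - p1) * v0 = 108 * (e * 300) by rewrite eE'; ring.
  by move: UD; lra.
have m0 : 0 < m%:R :> R by lra.
have := hW j; rewrite -/(w j); move: (w j) => wj.
have : `|U - (p0 + p1)| <= 108 / 300 * (p0 - p1) by lra.
rewrite !ler_norml => /andP[u1 u2].
by case: (rep j) => /andP[w1 w2]; [apply/idP | apply/negbTE; rewrite -ltNge]; nra.
Qed.

End Threshold.

(** * A Chernoff bound for i.i.d. bounded centred variables *)

Section IidTail.
Context {R : realType}.

(** [1 - x <= expR (- x)] gives [expR x <= 1 / (1 - x)], and [(1 + x + 2 * x ^+ 2) * (1 - x) - 1 = x
    ^+ 2 * (1 - 2 * x)]. *)
Lemma expR_le_quadratic (x : R) : x <= 2^-1 -> expR x <= 1 + x + 2 * x ^+ 2.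
Proof.
move=> x2; have h := expR_ge1Dx (- x); have e0 := expR_gt0 x.
have x1 : 0 < 1 - x by lra.
have : expR x * (1 - x) <= 1.
  rewrite -[leRHS](@mulfV _ (expR x)) ?gt_eqF // -expRN.
  by rewrite ler_pM2l //; lra.
rewrite -ler_pdivlMr // => /le_trans; apply.
rewrite ler_pdivrMr // -subr_ge0.
rewrite (_ : _ - 1 = x ^+ 2 * (1 - 2 * x)); last by ring.
by rewrite mulr_ge0 ?sqr_ge0 //; lra.
Qed.

Lemma sum_ffun_prod (I J : finType) (F : I -> J -> R) :
  \sum_(f : {ffun I -> J}) \prod_i F i (f i) = \prod_i \sum_j F i j.
Proof. by rewrite bigA_distr_bigA. Qed.

(** Exponential Markov inequality: as [b] is centred and bounded, its moment generating function at
    [l] is at most [1 + 2 * l ^+ 2 <= expR (2 * l ^+ 2)]. Probabilities are weighted sums over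
    tuples of values. *)
Lemma iid_tail (I : finType) (g b : I -> R) (N : nat) (e : R) :
  is_pmf g -> (forall i, `|b i| <= 1) -> \sum_i g i * b i = 0 -> 0 <= e <= 1 ->
  \sum_(f : {ffun 'I_N -> I} | e * N%:R <= \sum_t b (f t)) \prod_t g (f t)
    <= expR (- (e ^+ 2 / 8 * N%:R)).
Proof.
move=> [g0 g1] b1 gb0 /andP[e0 e1].
(* The minimizer of [2 * l ^+ 2 - l * e], with minimum [- e ^+ 2 / 8]. *)
pose l := e / 4.
have mgf : \sum_i g i * expR (l * b i) <= expR (2 * l ^+ 2).
  apply: le_trans (expR_ge1Dx _).
  apply: le_trans (_ : \sum_i (g i + l * (g i * b i) + 2 * l ^+ 2 * g i) <= _).
    apply: ler_sum => i _.
    have /andP[b2 b3] : -1 <= b i <= 1 by rewrite -ler_norml.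
    have lb : l * b i <= 2^-1 by rewrite /l; nra.
    have := ler_wpM2l (g0 i) (expR_le_quadratic _ lb) => /le_trans; apply.
    have -> : g i + l * (g i * b i) + 2 * l ^+ 2 * g i =
      g i * (1 + l * b i + 2 * l ^+ 2) by ring.
    apply: ler_wpM2l => //; rewrite lerD2l exprMn.
    have bb : b i ^+ 2 <= 1 by nra.
    have := sqr_ge0 l; nra.
  by rewrite !big_split /= -!mulr_sumr g1 gb0 mulr0 addr0 mulr1.
apply: le_trans (_ : \sum_(f : {ffun 'I_N -> I})
   (\prod_t g (f t)) * expR (l * (\sum_t b (f t) - e * N%:R)) <= _).
  rewrite big_mkcond /=; apply: ler_sum => f _.
  have p0 : 0 <= \prod_t g (f t) by apply: prodr_ge0.
  case: ifP => h; last by rewrite mulr_ge0 // expR_ge0.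
  rewrite ler_peMr // -[leLHS]expR0 ler_expR mulr_ge0 ?subr_ge0 //.
  by rewrite /l divr_ge0.
have -> : \sum_(f : {ffun 'I_N -> I})
   (\prod_t g (f t)) * expR (l * (\sum_t b (f t) - e * N%:R)) =
   expR (- (l * (e * N%:R))) * (\sum_i g i * expR (l * b i)) ^+ N.
  rewrite -[N in _ ^+ N]card_ord -prodr_const -sum_ffun_prod mulr_sumr.
  apply: eq_bigr => f _; rewrite big_split /= mulrCA; congr (_ * _).
  by rewrite mulrBr expRD mulr_sumr expR_sum mulrC.
apply: le_trans (_ : expR (- (l * (e * N%:R))) * expR (2 * l ^+ 2) ^+ N <= _).
  rewrite ler_pM2l ?expR_gt0 //; apply: lerXn2r => //; rewrite nnegrE ?expR_ge0 //.
  by apply: sumr_ge0 => i _; rewrite mulr_ge0 ?expR_ge0.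
rewrite -expRM_natl -expRD ler_expR /l le_eqVlt; apply/orP; left; apply/eqP.
by field.
Qed.

Lemma iid_tail_abs (I : finType) (g b : I -> R) (N : nat) (e : R) :
  is_pmf g -> (forall i, `|b i| <= 1) -> \sum_i g i * b i = 0 -> 0 <= e <= 1 ->
  \sum_(f : {ffun 'I_N -> I} | e * N%:R <= `|\sum_t b (f t)|) \prod_t g (f t)
    <= 2 * expR (- (e ^+ 2 / 8 * N%:R)).
Proof.
move=> gp b1 gb0 e01; rewrite mulr2n mulrDl !mul1r.
have hN : \sum_i g i * (- b i) = 0.
  by under eq_bigr do rewrite mulrN; rewrite sumrN gb0 oppr0.
have bN i : `|- b i| <= 1 by rewrite normrN.
apply: le_trans (lerD (iid_tail _ _ _ N e gp b1 gb0 e01) (iid_tail _ _ _ N e gp bN hN e01)).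
rewrite big_mkcond [X in _ <= X + _]big_mkcond [X in _ <= _ + X]big_mkcond.
rewrite -big_split /=; apply: ler_sum => f _.
have p0 : 0 <= \prod_t g (f t) by apply: prodr_ge0 => t _; case: gp.
rewrite sumrN lerNr.
case: ifP => [|_]; last by rewrite addr_ge0 //; case: ifP.
rewrite ler_normr => /orP[->|]; first by rewrite lerDl; case: ifP.
by rewrite lerNr => ->; rewrite lerDr; case: ifP.
Qed.

End IidTail.

(** * Expectations under product laws *)

Section ProductLaw.
Context {R : realType}.

(** [phi] is absorbed in factor [i]; once the sum is distributed over the product, each other factor
    sums to 1. *)
Lemma expect_coord (I J : finType) (q : I -> J -> R) (i : I) (phi : J -> R) :
  (forall i, is_pmf (q i)) ->
  \sum_(f : {ffun I -> J}) (\prod_k q k (f k)) * phi (f i) =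
  \sum_j q i j * phi j.
Proof.
move=> qp; pose F k j := q k j * (if k == i then phi j else 1).
have FE (f : {ffun I -> J}) : (\prod_k q k (f k)) * phi (f i) = \prod_k F k (f k).
  rewrite big_split /=; congr (_ * _).
  by rewrite (bigD1 i) //= eqxx big1 ?mulr1 // => k /negbTE ->.
rewrite (eq_bigr _ (fun f _ => FE f)) sum_ffun_prod (bigD1 i) //= [X in _ * X]big1 ?mulr1.
  by apply: eq_bigr => j _; rewrite /F eqxx.
move=> k /negbTE ki; rewrite -[RHS](qp k).2.
by apply: eq_bigr => j _; rewrite /F ki mulr1.
Qed.

Lemma expect_coord2 (I J : finType) (q : I -> J -> R) (i i' : I) (phi psi : J -> R) :
  i != i' -> (forall i, is_pmf (q i)) ->
  \sum_(f : {ffun I -> J}) (\prod_k q k (f k)) * (phi (f i) * psi (f i')) =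
  (\sum_j q i j * phi j) * (\sum_j q i' j * psi j).
Proof.
move=> ii' qp.
pose F k j := q k j * (if k == i then phi j else if k == i' then psi j else 1).
have i'i : (i' == i) = false by rewrite eq_sym (negbTE ii').
have FE (f : {ffun I -> J}) :
    (\prod_k q k (f k)) * (phi (f i) * psi (f i')) = \prod_k F k (f k).
  rewrite big_split /=; congr (_ * _).
  rewrite (bigD1 i) //= eqxx (bigD1 i') ?i'i //= eqxx big1 ?mulr1 //.
  by move=> k /andP[/negbTE -> /negbTE ->].
rewrite (eq_bigr _ (fun f _ => FE f)) sum_ffun_prod.
rewrite (bigD1 i) //= (bigD1 i') ?i'i //= [X in _ * (_ * X)]big1 ?mulr1.
  congr (_ * _); apply: eq_bigr => j _; rewrite /F ?eqxx //.
  by rewrite i'i.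
move=> k /andP[/negbTE ki /negbTE ki']; rewrite -[RHS](qp k).2.
by apply: eq_bigr => j _; rewrite /F ki ki' mulr1.
Qed.

Lemma prod_pmf (I J : finType) (q : I -> J -> R) : (forall i, is_pmf (q i)) ->
  is_pmf (fun f : {ffun I -> J} => \prod_k q k (f k)).
Proof.
move=> qp; split; first by move=> f; apply: prodr_ge0 => k _; case: (qp k).
by rewrite sum_ffun_prod big1 // => i _; case: (qp i).
Qed.

End ProductLaw.

(** * The law of one pair of matching rows *)

Section Rows.
Context {R : realType} {A : finType} (pX : A -> R) (pYX : A -> A -> R).
Hypotheses (pX_pmf : is_pmf pX) (pYX_channel : is_channel pYX).

(** One minus a collision probability: of two independent draws from the output law here, of two
    channel outputs sharing one input in [p_replica]. *)
Definition p_distinct : R := 1 - \sum_a output_pmf pX pYX a ^+ 2.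
Definition p_replica : R := 1 - \sum_a \sum_x pX x * pYX x a ^+ 2.

Lemma output_pmf_pmf : is_pmf (output_pmf pX pYX).
Proof.
split=> [y|].
  by apply: sumr_ge0 => x _; rewrite mulr_ge0 //; [case: pX_pmf | case: (pYX_channel x)].
rewrite /output_pmf exchange_big /= -[RHS](pX_pmf).2; apply: eq_bigr => x _.
by rewrite -mulr_sumr (pYX_channel x).2 mulr1.
Qed.

Lemma pmf_le1 (I : finType) (p : I -> R) i : is_pmf p -> p i <= 1.
Proof.
move=> [p0 p1]; rewrite -p1 (bigD1 i) //= lerDl.
by apply: sumr_ge0.
Qed.

Lemma p_bounds : p_distinct <= 1 /\ 0 <= p_replica.
Proof.
split; first by rewrite lerBlDr lerDl sumr_ge0 // => a _; rewrite sqr_ge0.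
rewrite subr_ge0 -[leRHS](output_pmf_pmf).2; apply: ler_sum => a _.
apply: ler_sum => x _; apply: ler_wpM2l; first by case: pX_pmf.
have h0 : 0 <= pYX x a by case: (pYX_channel x).
by rewrite expr2 ler_piMr // pmf_le1.
Qed.

(* [p_distinct - p_replica] is the sum over [a] of the variances of
   [pYX x a] under [pX]. *)
Lemma p_gap : full_support pX ->
  ~ (forall x y, joint_pmf pX pYX x y = pX x * output_pmf pX pYX y) ->
  p_replica < p_distinct.
Proof.
move=> pXs dep; rewrite /p_replica /p_distinct ltrD2l ltrN2 -subr_gt0 -sumrB.
have vE a : \sum_x pX x * pYX x a ^+ 2 - output_pmf pX pYX a ^+ 2 =
    \sum_x pX x * (pYX x a - output_pmf pX pYX a) ^+ 2.
  set c := output_pmf pX pYX a.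
  rewrite [RHS](eq_bigr (fun x => pX x * pYX x a ^+ 2 - 2 * c * joint_pmf pX pYX x a +
    c ^+ 2 * pX x)); last by move=> x _; rewrite /joint_pmf; ring.
  rewrite big_split sumrB /= -!mulr_sumr (pX_pmf).2 -/(output_pmf pX pYX a) -/c.
  by ring.
rewrite (eq_bigr _ (fun a _ => vE a)).
have v0 x a : 0 <= pX x * (pYX x a - output_pmf pX pYX a) ^+ 2.
  by rewrite mulr_ge0 ?sqr_ge0 //; case: pX_pmf.
rewrite lt_neqAle sumr_ge0 ?andbT; last by move=> a _; apply: sumr_ge0.
(* If the gap were zero, every variance would vanish, and the full support of [pX] would force
   [pYX x y = output_pmf pX pYX y], that is, independence. *)
apply/eqP => /esym/psumr_eq0P z; apply: dep => x y.
have /psumr_eq0P z' := z (fun a _ => sumr_ge0 _ (fun x _ => v0 x a)) y isT.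
have /eqP := z' (fun x _ => v0 x y) x isT.
rewrite mulf_eq0 gt_eqF ?pXs //= sqrf_eq0 subr_eq0 => /eqP e.
by rewrite /joint_pmf e.
Qed.

Context {smax n : nat} (s : {ffun 'I_n -> 'I_smax.+1}).

(** The joint law, given the pattern [s], of row [i] of [X] and row [sigma i] of [Y]. *)
Definition row_mass (r : {ffun 'I_n -> A} * {ffun 'I_(width s) -> A}) : R :=
  (\prod_j pX (r.1 j)) * \prod_k pYX (r.1 (origin s k)) (r.2 k).

Lemma row_mass_pmf : is_pmf row_mass.
Proof.
split=> [r|].
  apply: mulr_ge0; apply: prodr_ge0 => k _; first by case: pX_pmf.
  by case: (pYX_channel (r.1 (origin s k))).
rewrite -(pair_bigA _ (fun u v => row_mass (u, v))) /=.
have [_ <-] := prod_pmf 'I_n A (fun=> pX) (fun=> pX_pmf).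
apply: eq_bigr => u _; rewrite /row_mass /= -mulr_sumr.
have [_ ->] := prod_pmf _ A (fun k => pYX (u (origin s k)))
  (fun k => pYX_channel (u (origin s k))).
by rewrite mulr1.
Qed.

Lemma pick_value (p : A -> R) a : \sum_b p b * (b == a)%:R = p a.
Proof.
rewrite (bigD1 a) //= eqxx mulr1 big1 ?addr0 // => b /negbTE ->.
by rewrite mulr0.
Qed.

(** The probability of agreement splits over the common value [a]. Given the row [u] of [X], entries
    [k] and [l] are independent; averaging over [u] then involves one coordinate when the origins
    agree, two independent ones otherwise. *)
Lemma row_mass_match (k l : 'I_(width s)) : k != l ->
  \sum_r row_mass r * (r.2 l != r.2 k)%:R =
  if origin s k == origin s l then p_replica else p_distinct.
Proof.
move=> kl.
have mE : \sum_r row_mass r * (r.2 l == r.2 k)%:R = \sum_a \sum_(u : {ffun 'I_n -> A})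
    (\prod_j pX (u j)) * (pYX (u (origin s k)) a * pYX (u (origin s l)) a).
  rewrite exchange_big /= -(pair_bigA _ (fun u v => row_mass (u, v) * (v l == v k)%:R)) /=.
  apply: eq_bigr => u _; rewrite -[RHS]mulr_sumr.
  under eq_bigr => v _ do rewrite /row_mass /= -mulrA.
  rewrite -mulr_sumr; congr (_ * _); apply/esym.
  rewrite (eq_bigr (fun a => \sum_(v : {ffun 'I_(width s) -> A})
    (\prod_i pYX (u (origin s i)) (v i)) * ((v k == a)%:R * (v l == a)%:R))).
    rewrite exchange_big /=; apply: eq_bigr => v _; rewrite -mulr_sumr.
    congr (_ * _); rewrite (eq_bigr (fun a => (v l == a)%:R * (a == v k)%:R)).
      exact: (pick_value (fun a => (v l == a)%:R)).
    by move=> a _; rewrite mulrC (eq_sym a).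
  move=> a _; rewrite (expect_coord2 _ _ (fun i => pYX (u (origin s i))) k l
    (fun b => (b == a)%:R) (fun b => (b == a)%:R) kl (fun i => pYX_channel _)).
  by rewrite !pick_value.
have -> : \sum_r row_mass r * (r.2 l != r.2 k)%:R =
    1 - \sum_r row_mass r * (r.2 l == r.2 k)%:R.
  rewrite -[X in X - _](row_mass_pmf).2 -sumrB; apply: eq_bigr => r _.
  by case: eqP => _ /=; ring.
rewrite mE; case: eqP => [->|/eqP kl']; congr (1 - _); apply: eq_bigr => a _.
  exact: (expect_coord _ _ (fun=> pX) (origin s l) (fun x => pYX x a * pYX x a)).
exact: (expect_coord2 _ _ (fun=> pX) _ _ (fun x => pYX x a) (fun x => pYX x a) kl').
Qed.

End Rows.

(** * Factorization of the database law over rows *)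

Section Law.
Context {R : realType} {A : finType} (pX : A -> R) (pYX : A -> A -> R).
Hypotheses (pX_pmf : is_pmf pX) (pYX_channel : is_channel pYX).
Context {smax m n : nat} (s : {ffun 'I_n -> 'I_smax.+1}).

Local Notation row := ({ffun 'I_n -> A} * {ffun 'I_(width s) -> A})%type.
Local Notation mass := (row_mass pX pYX s).

(** Each column [k] lies in exactly one block, so the products over [j] and over the block of [j]
    collapse to one over [k], read at [origin s k]. *)
Lemma database_pmfE (pS : 'I_smax.+1 -> R) (x : 'M[A]_(m, n)) (pi : {perm 'I_m})
    (y : 'M[A]_(m, width s)) :
  database_pmf pX pYX pS x pi y = (\prod_j pS (s j)) * (m`!%:R)^-1 *
    \prod_i mass ([ffun j => x i j], [ffun k => y (pi i) k]).
Proof.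
rewrite /database_pmf -!mulrA [LHS]mulrC -!mulrA; congr (_ * (_ * _)).
rewrite mulrC -big_split /=; apply: eq_bigr => i _; rewrite /row_mass /=.
congr (_ * _); first by apply: eq_bigr => j _; rewrite ffunE.
rewrite (exchange_big_dep xpredT) //=; apply: eq_bigr => k _.
rewrite (eq_bigl (pred1 (origin s k))) ?big_pred1_eq ?ffunE // => j.
exact: origin_block.
Qed.

(* Row [i] of [x] is paired with row [pi i] of [y], which makes the pairs i.i.d. *)
Definition mx_of_rows (pi : {perm 'I_m}) (f : {ffun 'I_m -> row}) :=
  (\matrix_(i, j) (f i).1 j : 'M[A]_(m, n),
   \matrix_(i, k) (f (pi^-1%g i)).2 k : 'M[A]_(m, width s)).

Lemma mx_of_rows_bij pi : bijective (mx_of_rows pi).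
Proof.
exists (fun p : 'M[A]_(m, n) * 'M[A]_(m, width s) =>
    [ffun i => ([ffun j => p.1 i j], [ffun k => p.2 (pi i) k])]).
  move=> f; apply/ffunP => i; rewrite ffunE [RHS]surjective_pairing.
  by congr (_, _); apply/ffunP => j; rewrite ffunE mxE ?permK.
move=> [x y]; rewrite /mx_of_rows; congr (_, _); apply/matrixP => i j;
  by rewrite mxE ffunE /= ffunE ?permKV.
Qed.

(** A change of variables to [m] independent row pairs, the form expected by the tail bounds. *)
Lemma sum_rows (pi : {perm 'I_m}) (Q : pred 'M[A]_(m, width s)) :
  \sum_(x : 'M[A]_(m, n)) \sum_(y | Q y)
     \prod_i mass ([ffun j => x i j], [ffun k => y (pi i) k]) =
  \sum_(f | Q (mx_of_rows pi f).2) \prod_i mass (f i).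
Proof.
rewrite (pair_big xpredT Q) /= (reindex _ (onW_bij _ (mx_of_rows_bij pi))) /=.
apply: eq_bigr => f _; apply: eq_bigr => i _; congr mass.
rewrite [RHS]surjective_pairing.
by congr (_, _); apply/ffunP => j; rewrite ffunE mxE ?permK.
Qed.

Definition far (e : R) (y : 'M[A]_(m, width s)) (j : 'I_(width s).-1) : bool :=
  e * m%:R <= `|(running_hamming y j)%:R - m%:R *
    (if replicas s j then p_replica pX pYX else p_distinct pX pYX)|.

(** The Hamming distance minus its mean is a sum of [m] i.i.d. centred variables [b], one per row
    pair. *)
Lemma sum_far (pi : {perm 'I_m}) (e : R) (j : 'I_(width s).-1) : 0 <= e <= 1 ->
  \sum_(x : 'M[A]_(m, n)) \sum_(y | far e y j)
     \prod_i mass ([ffun j => x i j], [ffun k => y (pi i) k]) <=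
  2 * expR (- (e ^+ 2 / 8 * m%:R)).
Proof.
move=> e01; rewrite sum_rows.
set p := if replicas s j then p_replica pX pYX else p_distinct pX pYX.
pose b (r : row) : R := (r.2 (rcol j) != r.2 (lcol j))%:R - p.
have mp := row_mass_pmf pX pYX pX_pmf pYX_channel s.
have pE : \sum_r mass r * (r.2 (rcol j) != r.2 (lcol j))%:R = p.
  rewrite row_mass_match // /p ?replicasE //.
  by apply/eqP => /(congr1 val) /= /n_Sn.
have p01 : 0 <= p <= 1.
  rewrite -pE sumr_ge0 /=; last by move=> r _; rewrite mulr_ge0 ?ler0n ?mp.1.
  rewrite -[leRHS]mp.2; apply: ler_sum => r _.
  by rewrite ler_piMr ?mp.1 // lern1 leq_b1.
have b1 r : `|b r| <= 1.
  case/andP: p01 => p0 p1; rewrite /b ler_norml.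
  by case: eqP => _ /=; apply/andP; split; lra.
have b0 : \sum_r mass r * b r = 0.
  rewrite /b; under eq_bigr do rewrite mulrBr.
  by rewrite sumrB pE -mulr_suml mp.2 mul1r subrr.
apply: le_trans (iid_tail_abs _ _ _ m e mp b1 b0 e01).
rewrite le_eqVlt; apply/orP; left; apply/eqP; apply: eq_bigl => f.
rewrite /far -/p; congr (_ <= `|_|).
rewrite sumrB sumr_const card_ord mulr_natl; congr (_ - _).
(* The distance ignores the order of the rows, so [pi] reindexes away. *)
rewrite /running_hamming natr_sum (reindex_inj (@perm_inj _ pi)) /=.
by apply: eq_bigr => t _; rewrite !mxE permK.
Qed.

Lemma sum_pred_le1 (pi : {perm 'I_m}) (Q : pred 'M[A]_(m, width s)) :
  \sum_(x : 'M[A]_(m, n)) \sum_(y | Q y)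
     \prod_i mass ([ffun j => x i j], [ffun k => y (pi i) k]) <= 1.
Proof.
have mp := row_mass_pmf pX pYX pX_pmf pYX_channel s.
have [P0 P1] := prod_pmf _ _ (fun _ : 'I_m => mass) (fun=> mp).
rewrite sum_rows -[leRHS]P1 big_mkcond /=; apply: ler_sum => f _.
by case: ifP.
Qed.

End Law.

(** * Events as finite unions of atoms *)

Section Event.
Context {R : realType} {A : finType}.

Lemma bigsetU_iff (I : finType) (T : Type) (p : pred I) (F : I -> set T) w :
  (\big[setU/set0]_(i | p i) F i)%classic w <-> exists2 i, p i & F i w.
Proof.
rewrite -bigcup_seq_cond; split=> [[i /= /andP[_ pi] Fi]|[i pi Fi]]; first by exists i.
by exists i => //=; rewrite mem_index_enum.
Qed.

(** Measurability is carried along with the bound because subadditivity asks for it at each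
    union. *)
Definition measure_bounded (d : measure_display) (T : measurableType d)
    (P : probability T R) (B : set T) (b : R) :=
  measurable B /\ (P B <= b%:E)%E.

Lemma measure_bounded_bigU (d : measure_display) (T : measurableType d)
    (P : probability T R) (I : finType) (p : pred I) (F : I -> set T) (b : I -> R) :
  (forall i, p i -> measure_bounded d T P (F i) (b i)) ->
  measure_bounded d T P (\big[setU/set0]_(i | p i) F i)%classic (\sum_(i | p i) b i).
Proof.
move=> h; elim/big_ind2: _ => //; first by split; rewrite ?measure0.
move=> b1 B1 b2 B2 [mB1 PB1] [mB2 PB2]; split; first exact: measurableU.
by rewrite (le_trans (measureU2 P mB1 mB2)) // EFinD leeD.
Qed.

Context (pX : A -> R) (pYX : A -> A -> R).
Context {smax m n : nat} (pS : 'I_smax.+1 -> R).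
Context (d : measure_display) (T : measurableType d) (P : probability T R).
Context (X : T -> 'M[A]_(m, n)) (S : T -> {ffun 'I_n -> 'I_smax.+1}).
Context (sigma : T -> {perm 'I_m}) (Y : forall w : T, 'M[A]_(m, width (S w))).

Lemma event_le (Q : forall s, 'M[A]_(m, width s) -> bool) :
  correlated_databases pX pYX pS P X sigma Y ->
  measure_bounded d T P [set w | Q (S w) (Y w)]%classic
    (\sum_s \sum_(pi : {perm 'I_m}) \sum_x \sum_(y | Q s y) database_pmf pX pYX pS x pi y).
Proof.
move=> law.
pose atom s pi x (y : 'M[A]_(m, width s)) := [set w : T | [/\ X w = x, sigma w = pi &
  existT (fun s' => 'M[A]_(m, width s')) (S w) (Y w) =
  existT (fun s' => 'M[A]_(m, width s')) s y]]%classic.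
have -> : [set w | Q (S w) (Y w)]%classic = (\big[setU/set0]_s \big[setU/set0]_(pi : {perm 'I_m})
    \big[setU/set0]_x \big[setU/set0]_(y | Q s y) atom s pi x y)%classic.
  apply/seteqP; split=> [w /= Qw|w].
    do 3![apply/bigsetU_iff; eexists; first by []].
    by apply/bigsetU_iff; exists (Y w).
  case/bigsetU_iff => s _ /bigsetU_iff[pi _] /bigsetU_iff[x _] /bigsetU_iff[y Qy].
  (* The type of [Y w] depends on [S w], so the equality of dependent pairs is rewritten inside a
     predicate [Q'] on such pairs. *)
  case=> _ _ e /=; pose Q' (u : {s & 'M[A]_(m, width s)}) := Q (projT1 u) (projT2 u).
  by change (Q' (existT _ (S w) (Y w))); rewrite e.
apply: measure_bounded_bigU => s _; apply: measure_bounded_bigU => pi _.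
apply: measure_bounded_bigU => x _; apply: measure_bounded_bigU => y _.
by have [m_atom P_atom] := law x s pi y; split; [exact: m_atom | rewrite P_atom].
Qed.

End Event.

(** * Probability of an atypical database and of an error *)

Section ErrorBound.
Context {R : realType} {A : finType} (pX : A -> R) (pYX : A -> A -> R).
Context {smax : nat} (pS : 'I_smax.+1 -> R).
Hypotheses (pX_pmf : is_pmf pX) (pYX_channel : is_channel pYX) (pS_pmf : is_pmf pS).
Hypotheses (pX_supp : full_support pX) (pS_supp : full_support pS).
Hypotheses (smax_ge2 : (2 <= smax)%N).
Hypothesis dependent : ~ (forall x y : A,
  joint_pmf pX pYX x y = pX x * output_pmf pX pYX y).

Definition p_repeat : R := \sum_(v : 'I_smax.+1 | (2 <= v)%N) pS v.

(** Positivity: [2 <= smax] puts the value [ord_max], of positive mass, in the sum. *)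
Lemma p_repeat_bounds : 0 < p_repeat <= 1.
Proof.
apply/andP; split.
  rewrite /p_repeat (bigD1 ord_max) //= ltr_pwDl ?pS_supp //.
  by apply: sumr_ge0 => v _; case: pS_pmf.
rewrite -[leRHS](pS_pmf).2 [leRHS](bigID (fun v : 'I_smax.+1 => (2 <= v)%N)) /= lerDl.
by apply: sumr_ge0 => v _; case: pS_pmf.
Qed.

(** The Chernoff bound at deviation [p_repeat / 2] for the centred variables [b (s t)], whose sum is
    [p_repeat * n - repeated s]. *)
Lemma few_repeated n :
  \sum_(s : {ffun 'I_n -> 'I_smax.+1} | (repeated s)%:R < p_repeat / 2 * n%:R)
     \prod_j pS (s j) <= expR (- ((p_repeat / 2) ^+ 2 / 8 * n%:R)).
Proof.
have /andP[q0 q1] := p_repeat_bounds.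
pose b (v : 'I_smax.+1) : R := p_repeat - (2 <= v)%N%:R.
have b1 v : `|b v| <= 1.
  by rewrite /b ler_norml; case: (2 <= v)%N => /=; apply/andP; split; lra.
have b0 : \sum_v pS v * b v = 0.
  rewrite /b; under eq_bigr do rewrite mulrBr.
  rewrite sumrB -mulr_suml (pS_pmf).2 mul1r; apply/eqP; rewrite subr_eq0; apply/eqP.
  rewrite /p_repeat big_mkcond; apply: eq_bigr => v _.
  by case: ifP; rewrite ?mulr1 ?mulr0.
have e01 : 0 <= p_repeat / 2 <= 1 by apply/andP; split; lra.
apply: le_trans (iid_tail _ _ _ n (p_repeat / 2) pS_pmf b1 b0 e01).
have bE (s : {ffun 'I_n -> 'I_smax.+1}) :
    \sum_t b (s t) = p_repeat * n%:R - (repeated s)%:R.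
  rewrite sumrB sumr_const card_ord mulr_natr; congr (_ - _).
  by rewrite -natr_sum -big_mkcond sum1_card /repeated cardsE.
rewrite big_mkcond [leRHS]big_mkcond; apply: ler_sum => s _.
have p0 : 0 <= \prod_j pS (s j) by apply: prodr_ge0 => j _; case: pS_pmf.
rewrite bE; case: ifP => h; last by case: ifP.
by rewrite ifT //; lra.
Qed.

Lemma database_pmf_ge0 m n (x : 'M[A]_(m, n)) (s : {ffun 'I_n -> 'I_smax.+1})
    (pi : {perm 'I_m}) (y : 'M[A]_(m, width s)) :
  0 <= database_pmf pX pYX pS x pi y.
Proof.
rewrite database_pmfE; apply: mulr_ge0; last first.
  by apply: prodr_ge0 => i _; case: (row_mass_pmf pX pYX pX_pmf pYX_channel s).
by rewrite mulr_ge0 ?invr_ge0 ?ler0n // prodr_ge0 // => j _; case: pS_pmf.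
Qed.

Definition atypical m n e (s : {ffun 'I_n -> 'I_smax.+1}) (y : 'M[A]_(m, width s)) :=
  ((repeated s)%:R < p_repeat / 2 * n%:R) || [exists j, far pX pYX s e y j].

(** The first alternative of [atypical] does not involve [y]: either [s] has few repeated columns
    and the total mass 1 is the bound, or a union bound runs over the at most [smax * n] pairs. The
    indicator is kept for the later average over [s]. *)
Lemma sum_atypical m n (s : {ffun 'I_n -> 'I_smax.+1}) (pi : {perm 'I_m}) e :
  0 <= e <= 1 ->
  \sum_(x : 'M[A]_(m, n)) \sum_(y | atypical m n e s y)
    \prod_i row_mass pX pYX s ([ffun j => x i j], [ffun k => y (pi i) k]) <=
  ((repeated s)%:R < p_repeat / 2 * n%:R)%R%:R +
    2 * smax%:R * n%:R * expR (- (e ^+ 2 / 8 * m%:R)).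
Proof.
move=> e01; rewrite /atypical; case: ltP => _ /=.
  apply: le_trans (sum_pred_le1 _ _ pX_pmf pYX_channel _ _ _) _.
  by rewrite lerDl !mulr_ge0 ?expR_ge0.
rewrite add0r.
apply: le_trans (_ : \sum_(j < (width s).-1) 2 * expR (- (e ^+ 2 / 8 * m%:R)) <= _); last first.
  rewrite sumr_const card_ord -[leLHS]mulr_natl mulrCA -!mulrA ler_pM2l ?ltr0n //.
  rewrite [leRHS]mulrA ler_wpM2r ?expR_ge0 // -natrM ler_nat.
  exact: leq_trans (leq_pred _) (width_le s).
have le_far (j : 'I_(width s).-1) := sum_far _ _ pX_pmf pYX_channel s pi e j e01.
apply: le_trans (ler_sum _ (fun j _ => le_far j)).
rewrite [leRHS]exchange_big /=; apply: ler_sum => x _.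
rewrite big_mkcond; under [leRHS]eq_bigr do rewrite big_mkcond.
rewrite [leRHS]exchange_big /=; apply: ler_sum => y _.
have g0 : 0 <= \prod_i row_mass pX pYX s ([ffun j => x i j], [ffun k => y (pi i) k]).
  by apply: prodr_ge0 => i _; case: (row_mass_pmf pX pYX pX_pmf pYX_channel s).
case: existsP => [[j hj]|_]; last by apply: sumr_ge0 => j _; case: ifP.
rewrite (bigD1 j) //= hj lerDl.
by apply: sumr_ge0 => i _; case: ifP.
Qed.

(** Summing over [pi] cancels the factor [1 / m!], and averaging the indicator over [s] leaves
    [few_repeated]. *)
Lemma prob_atypical m n e : 0 <= e <= 1 ->
  \sum_(s : {ffun 'I_n -> 'I_smax.+1}) \sum_(pi : {perm 'I_m})
    \sum_(x : 'M[A]_(m, n)) \sum_(y | atypical m n e s y)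
    database_pmf pX pYX pS x pi y <=
  expR (- ((p_repeat / 2) ^+ 2 / 8 * n%:R)) +
  2 * smax%:R * n%:R * expR (- (e ^+ 2 / 8 * m%:R)).
Proof.
move=> e01; set c := 2 * _ * _ * _.
apply: le_trans (_ : \sum_(s : {ffun 'I_n -> 'I_smax.+1}) (\prod_j pS (s j)) *
  (((repeated s)%:R < p_repeat / 2 * n%:R)%R%:R + c) <= _).
  apply: ler_sum => s _.
  have pS0 : 0 <= \prod_j pS (s j) by apply: prodr_ge0 => j _; case: pS_pmf.
  have f0 : 0 < m`!%:R :> R by rewrite ltr0n fact_gt0.
  have -> : (\prod_j pS (s j)) * (((repeated s)%:R < p_repeat / 2 * n%:R)%R%:R + c) =
    \sum_(pi : {perm 'I_m}) (\prod_j pS (s j)) * (m`!%:R)^-1 *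
      (((repeated s)%:R < p_repeat / 2 * n%:R)%R%:R + c).
    rewrite sumr_const (_ : #|_| = m`!); last by rewrite -card_Sn; apply: eq_card => x; rewrite inE.
    by rewrite -mulr_natl; field; rewrite gt_eqF.
  apply: ler_sum => pi _.
  rewrite (eq_bigr (fun x : 'M[A]_(m, n) => (\prod_j pS (s j)) * (m`!%:R)^-1 *
    \sum_(y | atypical m n e s y)
      \prod_i row_mass pX pYX s ([ffun j => x i j], [ffun k => y (pi i) k])));
    last by move=> x _; rewrite mulr_sumr; apply: eq_bigr => y _; exact: database_pmfE.
  rewrite -mulr_sumr ler_wpM2l ?sum_atypical //.
  by rewrite mulr_ge0 // invr_ge0 ltW.
under eq_bigr do rewrite mulrDr.
rewrite big_split /= -mulr_suml.
have [_ ->] := prod_pmf 'I_n _ (fun=> pS) (fun=> pS_pmf).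
rewrite mul1r lerD2r; apply: le_trans (few_repeated n).
rewrite [leRHS]big_mkcond; apply: ler_sum => s _.
by case: ltP; rewrite ?mulr1 ?mulr0.
Qed.

(* Typically [repeated s >= p_repeat * n / 2]; of the at most [smax * n] pairs, at
   least [repeated s] are replicas and [repeated s - 1 >= repeated s / 2] are not. *)
Definition min_fraction : R := p_repeat / (4 * smax%:R).
(** The [e] of [detect_correct] for [d = min_fraction]. *)
Definition tolerance : R :=
  min_fraction ^+ 2 * (p_distinct pX pYX - p_replica pX pYX) ^+ 3 / 300.

Lemma min_fraction_bounds : 0 < min_fraction <= 1.
Proof.
have /andP[q0 q1] := p_repeat_bounds.
have s1 : 2 <= smax%:R :> R by rewrite (ler_nat _ 2).
by rewrite /min_fraction ler_pdivrMr ?divr_gt0 //=; lra.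
Qed.

Lemma p_order : 0 <= p_replica pX pYX < p_distinct pX pYX /\ p_distinct pX pYX <= 1.
Proof.
have [p01 p10] := p_bounds pX pYX pX_pmf pYX_channel.
have gap := p_gap pX pYX pX_pmf pX_supp dependent.
by rewrite p10 gap p01.
Qed.

Lemma tolerance_bounds : 0 < tolerance <= 1.
Proof.
have /andP[d0 d1] := min_fraction_bounds.
have [/andP[p10 gap] p01] := p_order.
have D0 : 0 < p_distinct pX pYX - p_replica pX pYX by lra.
have D1 : p_distinct pX pYX - p_replica pX pYX <= 1 by lra.
have num0 := mulr_gt0 (exprn_gt0 2 d0) (exprn_gt0 3 D0).
have num1 : min_fraction ^+ 2 * (p_distinct pX pYX - p_replica pX pYX) ^+ 3 <= 1.
  by apply: mulr_ile1; rewrite ?exprn_ge0 ?exprn_ile1 // ltW.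
by rewrite /tolerance; apply/andP; split; lra.
Qed.

Definition wrong m n (s : {ffun 'I_n -> 'I_smax.+1}) (y : 'M[A]_(m, width s)) :=
  [exists j : 'I_(width s).-1, detect R y j != Some (replicas s j)].

Lemma wrong_atypical m n (s : {ffun 'I_n -> 'I_smax.+1}) (y : 'M[A]_(m, width s)) :
  4 <= tolerance * m%:R -> 4 <= p_repeat * n%:R ->
  wrong m n s y -> atypical m n tolerance s y.
Proof.
move=> em en; apply: contraTT; rewrite /atypical negb_or -leNgt => /andP[h1 /existsPn h2].
apply/existsPn => j; rewrite negbK; apply/eqP.
have [pp p01] := p_order.
have /andP[q0 q1] := p_repeat_bounds.
have s0 : 0 < smax%:R :> R by rewrite ltr0n (leq_trans _ smax_ge2).
have KR : min_fraction * (width s).-1%:R <= p_repeat / 4 * n%:R.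
  apply: le_trans (_ : min_fraction * (smax * n)%:R <= _).
    apply: ler_wpM2l; first by case/andP: min_fraction_bounds => /ltW.
    by rewrite ler_nat; exact: leq_trans (leq_pred _) (width_le s).
  by rewrite natrM /min_fraction le_eqVlt; apply/orP; left; apply/eqP; field; rewrite gt_eqF.
apply: (detect_correct A m (width s) y (fun j => replicas s j) _ _ min_fraction tolerance
   pp p01 min_fraction_bounds erefl em).
(* The index [j] itself witnesses that some pair exists. *)
- by case: ((width s).-1) j => [[]|].
- apply: le_trans (_ : (repeated s)%:R <= _); last by rewrite ler_nat repeated_replicas.
  by lra.
- apply: le_trans (_ : (repeated s).-1%:R <= _); last by rewrite ler_nat repeated_nonreplicas.
  (* [repeated s >= p_repeat * n / 2 >= 2], whence [repeated s - 1 >= p_repeat * n / 4]. *)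
  have r0 : (0 < repeated s)%N by rewrite -(ltr_nat R); lra.
  by rewrite -[(repeated s).-1]subn1 natrB //; lra.
- by move=> i; have := h2 i; rewrite /far -ltNge => /ltW.
Qed.

Lemma error_bound m n (d : measure_display) (T : measurableType d)
    (P : probability T R) (X : T -> 'M[A]_(m, n)) (S : T -> {ffun 'I_n -> 'I_smax.+1})
    (sigma : T -> {perm 'I_m}) (Y : forall w : T, 'M[A]_(m, width (S w))) :
  correlated_databases pX pYX pS P X sigma Y ->
  4 <= tolerance * m%:R -> 4 <= p_repeat * n%:R ->
  (P (\bigcup_j detection_error R Y j)%classic <=
   (expR (- ((p_repeat / 2) ^+ 2 / 8 * n%:R)) +
    2 * smax%:R * n%:R * expR (- (tolerance ^+ 2 / 8 * m%:R)))%:E)%E.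
Proof.
move=> law em en.
have -> : (\bigcup_j detection_error R Y j)%classic =
    [set w | wrong m n (S w) (Y w)]%classic.
  apply/seteqP; split=> w.
    by move=> [j _ [lt_j /eqP h]]; apply/existsP; exists (Ordinal lt_j).
  move=> /existsP[j /eqP h]; exists (val j) => //.
  by exists (ltn_ord j); rewrite (_ : Ordinal _ = j) //; apply: val_inj.
have [_ /le_trans] := event_le _ _ _ _ _ P _ _ _ _ (wrong m n) law; apply.
rewrite lee_fin; apply: le_trans (prob_atypical m n tolerance _); last first.
  by case/andP: tolerance_bounds => /ltW -> ->.
apply: ler_sum => s _; apply: ler_sum => pi _; apply: ler_sum => x _.
rewrite big_mkcond [leRHS]big_mkcond; apply: ler_sum => y _.
case: ifP => [/wrong_atypical -> //|_].
by case: ifP => // _; apply: database_pmf_ge0.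
Qed.

End ErrorBound.

(** * Asymptotics in [n] *)

Local Open Scope classical_set_scope.

(** Eventually [c2 * m n >= 2 * ln n], so [n * expR (- (c2 * m n)) <= 1 / n], while
    [1 + x <= expR x] gives [expR (- (c1 * n)) <= 1 / (c1 * n)]. *)
Lemma error_rate_cvg0 (R : realType) (m : nat -> nat) (c1 c2 k : R) : 0 < c1 -> 0 < c2 -> 0 <= k ->
  (m n)%:R / ln (n%:R : R) @[n --> \oo] --> +oo ->
  expR (- (c1 * n%:R)) + k * n%:R * expR (- (c2 * (m n)%:R)) @[n --> \oo] --> (0 : R).
Proof.
move=> c10 c20 k0 /cvgry_ge mlog.
(* The factor 2 accounts for [harmonic n = 1 / (n + 1)], as [1 / n <= 2 / (n + 1)]. *)
pose C := 2 * (c1^-1 + k).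
have CE : (fun n => C * harmonic n) @ \oo --> (0 : R).
  by rewrite -(mulr0 C); apply: cvgMl_tmp; exact: cvg_harmonic.
apply: (squeeze_cvgr _ (cvg_cst 0) CE).
near=> n.
have n2 : (2 <= n)%N by near: n; exact: nbhs_infty_ge.
have n0 : 0 < n%:R :> R by rewrite ltr0n (leq_trans _ n2).
have ln0 : 0 < ln (n%:R : R) by rewrite ln_gt0 // ltr1n.
have mn : 2 / c2 <= (m n)%:R / ln (n%:R : R) by near: n; exact: mlog.
have m_ln : 2 * ln (n%:R : R) <= c2 * (m n)%:R.
  by move: mn; rewrite ler_pdivlMr // mulrAC ler_pdivrMr // [leRHS]mulrC.
have e1 : expR (- (c1 * n%:R)) <= c1^-1 * n%:R^-1.
  rewrite expRN -invfM lef_pV2 ?posrE ?expR_gt0 ?mulr_gt0 //.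
  by apply: le_trans (expR_ge1Dx _); rewrite lerDr.
have e2 : n%:R * expR (- (c2 * (m n)%:R)) <= n%:R^-1.
  apply: le_trans (_ : n%:R * expR (- (2 * ln n%:R)) <= _).
    by rewrite ler_pM2l // ler_expR lerN2.
  rewrite expRN expRM_natl lnK ?posrE // le_eqVlt; apply/orP; left; apply/eqP.
  by field; rewrite gt_eqF.
have e0 := mulr_ge0 k0 (mulr_ge0 (ltW n0) (expR_ge0 (- (c2 * (m n)%:R)))).
apply/andP; split; first by rewrite addr_ge0 ?expR_ge0 // -mulrA.
apply: le_trans (_ : (c1^-1 + k) * n%:R^-1 <= _).
  by rewrite mulrDl -mulrA; apply: lerD => //; apply: ler_wpM2l.
have ck : 0 <= c1^-1 + k by rewrite addr_ge0 // invr_ge0 ltW.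
rewrite /C [2 * _]mulrC -mulrA; apply: (ler_wpM2l ck).
rewrite /harmonic /= ler_pdivlMr ?ltr0n //.
rewrite mulrC ler_pdivrMr // -natr1; have : 1 <= n%:R :> R by rewrite ler1n ltnW.
by lra.
Unshelve. all: by end_near.
Qed.

(** For [n >= 2], [ln n >= ln 2 > 0], so a lower bound on the ratio passes to [m n]. *)
Lemma sample_size_ge (R : realType) (m : nat -> nat) (e : R) : 0 < e ->
  (m n)%:R / ln (n%:R : R) @[n --> \oo] --> +oo ->
  \forall n \near \oo, 4 <= e * (m n)%:R.
Proof.
move=> e0 /cvgry_ge mlog; near=> n.
have n2 : (2 <= n)%N by near: n; exact: nbhs_infty_ge.
have l2 : 0 < ln (2 : R) by rewrite ln_gt0 // ltr1n.
have ln2 : ln (2 : R) <= ln n%:R by rewrite ler_ln ?posrE ?ltr0n ?ler_nat ?(leq_trans _ n2).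
have mn : 4 / (e * ln 2) <= (m n)%:R / ln (n%:R : R) by near: n; exact: mlog.
have mn' : 4 / (e * ln 2) * ln 2 <= (m n)%:R.
  apply: le_trans (_ : 4 / (e * ln 2) * ln n%:R <= _).
    by apply: ler_wpM2l => //; rewrite divr_ge0 // mulr_ge0 // ltW.
  by rewrite -ler_pdivlMr // (lt_le_trans l2).
have eE : e * (4 / (e * ln (2 : R)) * ln 2) = 4 by field; rewrite !gt_eqF.
by have := ler_wpM2l (ltW e0) mn'; rewrite eE.
Unshelve. all: by end_near.
Qed.


Theorem lemma1 (R : realType) (A : finType)
    (pX : A -> R) (pYX : A -> A -> R) (smax : nat) (pS : 'I_smax.+1 -> R)
    (m : nat -> nat)
    (d : nat -> measure_display) (T : forall n, measurableType (d n))
    (P : forall n, probability (T n) R)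
    (X : forall n, T n -> 'M[A]_(m n, n))
    (S : forall n, T n -> {ffun 'I_n -> 'I_smax.+1})
    (sigma : forall n, T n -> {perm 'I_(m n)})
    (Y : forall n (w : T n), 'M[A]_(m n, width (S n w)))
    (pX_pmf : is_pmf pX) (pX_supp : full_support pX)
    (pYX_channel : is_channel pYX)
    (pS_pmf : is_pmf pS) (pS_supp : full_support pS)
    (smax_ge2 : (2 <= smax)%N)
    (dependent : ~ (forall x y : A,
       joint_pmf pX pYX x y = pX x * output_pmf pX pYX y))
    (databases : forall n, correlated_databases pX pYX pS (P n)
       (X n) (sigma n) (Y n))
    (m_omega_log : (m n)%:R / ln (n%:R : R) @[n --> \oo] --> +oo) :
  P n (\bigcup_j detection_error R (Y n) j) @[n --> \oo] --> 0%E.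
Proof.
have tol0 : 0 < tolerance pX pYX pS.
  by have /andP[] := tolerance_bounds pX pYX pS pX_pmf pYX_channel pS_pmf pX_supp
    pS_supp smax_ge2 dependent.
have /andP[q0 _] := p_repeat_bounds pS pS_pmf pS_supp smax_ge2.
have c1 : 0 < (p_repeat pS / 2) ^+ 2 / 8 by rewrite divr_gt0 ?exprn_gt0 ?divr_gt0.
have c2 : 0 < tolerance pX pYX pS ^+ 2 / 8 by rewrite divr_gt0 ?exprn_gt0.
have k0 : 0 <= 2 * smax%:R :> R by rewrite mulr_ge0.
have bound0 := error_rate_cvg0 _ _ _ _ _ c1 c2 k0 m_omega_log.
(* [error_bound] applies once [n] and [m n] are large, which suffices for the squeeze. *)
have small : \forall n \near \oo,
    (0 <= P n (\bigcup_j detection_error R (Y n) j) <=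
     (expR (- ((p_repeat pS / 2) ^+ 2 / 8 * n%:R)) + 2 * smax%:R * n%:R *
      expR (- (tolerance pX pYX pS ^+ 2 / 8 * (m n)%:R)))%:E)%E.
  near=> n; rewrite measure_ge0 /=.
  have em : 4 <= tolerance pX pYX pS * (m n)%:R by near: n; exact: sample_size_ge.
  have qn : 4 / p_repeat pS <= n%:R by near: n; exact: nbhs_infty_ger.
  apply: error_bound (databases n) em _ => //.
  by rewrite -ler_pdivrMl // mulrC.
apply: (squeeze_cvge small); first exact: cvg_cst.
apply: cvg_EFin; [by near=> n | exact: bound0].
Unshelve. all: by end_near.
Qed.
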